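(* Let $I$ be a finite set with $|I|=n$. The linear map $\mathcal G:\mathbf M[I]\to\mathbb R[U_\alpha:\alpha\in\{0,1\}^n]$, $$\mathcal G(M)=\sum_{\ell}U_{\mathrm{rkjump}_M(\ell)},$$ summing over all linear orders $\ell=(\ell_1,\dots,\ell_n)$ of $I$, is a strong valuation on matroids: there is a linear map $\hat{\mathcal G}$ on the span of indicator functions of matroid polytopes of matroids on $I$ with $\mathcal G(M)=\hat{\mathcal G}(\mathbb 1_{P(M)})$ for every matroid $M$ on $I$.
   Context: A matroid $M$ on $I$ is a nonempty collection of subsets of $I$ (bases) satisfying the basis exchange axiom; its rank function is $\operatorname{rk}(J)=\max_B|J\cap B|$ over bases $B$. $\mathbf M[I]$ is the vector space with basis the matroids on $I$; $P(M)=\operatorname{conv}\{\sum_{b\in B}e_b: B\text{ a basis}\}$. For a linear order $\ell=(\ell_1,\dots,\ell_n)$ of $I$, $\mathrm{rkjump}_M(\ell)\in\{0,1\}^n$ has $i$-th entry $\operatorname{rk}(\{\ell_1,\dots,\ell_i\})-\operatorname{rk}(\{\ell_1,\dots,\ell_{i-1}\})$. The $U_\alpha$ are independent commuting variables indexed by $\{0,1\}^n$. *)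

(* Defs.v *)
From Stdlib Require Import ClassicalEpsilon.
From mathcomp Require Import all_boot all_order all_algebra.
From mathcomp Require Import mpoly.
Set Implicit Arguments. Unset Strict Implicit. Unset Printing Implicit Defensive.
Import Order.TTheory GRing.Theory Num.Theory.
Local Open Scope ring_scope.

Section Matroids.
Variable I : finType.

Definition is_matroid (bases : {set {set I}}) : Prop :=
  bases != set0 /\
  forall B1 B2, B1 \in bases -> B2 \in bases ->
    forall x, x \in B1 :\: B2 ->
      exists2 y, y \in B2 :\: B1 & (y |: (B1 :\ x)) \in bases.

Definition rk (bases : {set {set I}}) (J : {set I}) : nat :=
  \max_(B in bases) #|J :&: B|.

(* For a linear order l = (l_0, ..., l_{n-1}) of I (an injective map 'I_n -> I),
   the i-th entry of rkjump is rk{l_0..l_i} - rk{l_0..l_{i-1}} (which is 0 or 1),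
   encoded as a boolean (true = 1). *)
Definition rkjump (n : nat) (bases : {set {set I}}) (l : {ffun 'I_n -> I})
  : {ffun 'I_n -> bool} :=
  [ffun i : 'I_n =>
     (rk bases [set l j | j in [set j : 'I_n | (j <= i)%N]]
      - rk bases [set l j | j in [set j : 'I_n | (j < i)%N]] == 1)%N].

Definition Uvar (R : nzRingType) (n : nat) (a : {ffun 'I_n -> bool})
  : {mpoly R[#|{ffun 'I_n -> bool}|]} :=
  'X_(enum_rank a).

Definition Gval (R : nzRingType) (n : nat) (bases : {set {set I}})
  : {mpoly R[#|{ffun 'I_n -> bool}|]} :=
  \sum_(l : {ffun 'I_n -> I} | injectiveb l) Uvar R (rkjump bases l).

Definition in_polytope (R : realFieldType) (bases : {set {set I}})
  (x : I -> R) : Prop :=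
  exists lam : {set I} -> R,
    (forall B, 0 <= lam B) /\
    \sum_(B in bases) lam B = 1 /\
    forall i, x i = \sum_(B in bases) lam B * (i \in B)%:R.

Definition indicator_polytope (R : realFieldType) (bases : {set {set I}})
  : (I -> R) -> R :=
  fun x => if excluded_middle_informative (in_polytope bases x) then 1 else 0.

Definition in_indicator_span (R : realFieldType) (f : (I -> R) -> R) : Prop :=
  exists s : seq (R * {set {set I}}),
    (forall p, p \in s -> is_matroid p.2) /\
    forall x, f x = \sum_(p <- s) p.1 * indicator_polytope p.2 x.

End Matroids.

(* Main.v *)
Require Import Defs.
From Stdlib Require Import ClassicalEpsilon.
From mathcomp Require Import all_boot all_order all_algebra.
From mathcomp Require Import mpoly ring lra zify.
Import Order.TTheory GRing.Theory Num.Theory.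
Local Open Scope ring_scope.

Set Implicit Arguments.
Unset Strict Implicit.
Unset Printing Implicit Defensive.

(** Let [J_0 <= ... <= J_n] be the flag of initial segments of a linear order.
    Some basis of a matroid meets every [J_i] in [rk J_i] elements, so the matroid
    polytope meets the region [x(J_i) >= r_i for all i] exactly when
    [rk J_i >= r_i] for all [i], and adding the inequality
    [sum_i x(J_i) >= sum_i r_i + 1] excludes exactly the case of equality
    everywhere. Hence the event that the rank vector along the flag is [r] is a
    difference of two functionals of the form "[P] meets the polyhedron [K]".
    Such a functional respects linear relations between indicator functions: it is
    the Euler characteristic of the intersection of [P] and [K], computed by
    projecting away one coordinate at a time. Fourier-Motzkin elimination shows
    that the fibres of each projection are closed intervals, and a relation between
    indicators of closed bounded intervals forces the coefficients of the nonempty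
    ones to sum to zero. *)

(** * Bases of matroids *)

Section Bases.
Variables (I : finType) (bases : {set {set I}}).
Hypothesis bases_matroid : is_matroid bases.

Let exchange B1 B2 x : B1 \in bases -> B2 \in bases -> x \in B1 :\: B2 ->
  exists2 y, y \in B2 :\: B1 & (y |: (B1 :\ x)) \in bases.
Proof. by move=> B1b B2b; apply: bases_matroid.2. Qed.

Lemma card_exchange (B : {set I}) x y :
  x \in B -> y \notin B -> #|y |: (B :\ x)| = #|B|.
Proof.
move=> xB yB; rewrite cardsU1 !inE (negPf yB) andbF /=.
by rewrite [in RHS](cardsD1 x) xB.
Qed.

Lemma exchange_setD (B1 B2 : {set I}) x y : x \in B1 :\: B2 -> y \in B2 ->
  (#|(y |: (B1 :\ x)) :\: B2| < #|B1 :\: B2|)%N.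
Proof.
move=> xB yB; rewrite (cardsD1 x (B1 :\: B2)) xB add1n ltnS.
apply/subset_leq_card/subsetP=> z; rewrite !inE.
by case/andP=> zB2 /orP[/eqP ez|/andP[-> ->]]; [rewrite ez yB in zB2 | rewrite zB2].
Qed.

(** Each exchange keeps the size of the first basis and brings it closer to the second, until it is
    contained in it. *)
Lemma card_basis B1 B2 : B1 \in bases -> B2 \in bases -> #|B1| = #|B2|.
Proof.
suff le : forall m C1 C2, (#|C1 :\: C2| < m)%N -> C1 \in bases ->
    C2 \in bases -> (#|C1| <= #|C2|)%N.
  by move=> b1 b2; apply/eqP; rewrite eqn_leq !(le _ _ _ (ltnSn _)).
elim=> // m IHm C1 C2 lt_m C1b C2b.
have [/subset_leq_card //|/subsetPn[x xC1 xC2]] := boolP (C1 \subset C2).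
have xD : x \in C1 :\: C2 by rewrite inE xC1 xC2.
have [y] := exchange C1b C2b xD; rewrite inE => /andP[yC1 yC2] C3b.
rewrite -(card_exchange xC1 yC1); apply: IHm => //.
by rewrite -ltnS; apply: leq_trans lt_m; rewrite ltnS exchange_setD.
Qed.

(** While [B'] has an element outside [J] and [B], exchange it for one of [B]: [B' :\: B] shrinks
    and [J :&: B'] loses nothing. Once [B' :\: B] lies in [J], every partner [y] taken from it is in
    [J]. *)
Lemma exchange_into (J B B' : {set I}) : B \in bases -> B' \in bases ->
  (#|J :&: B| < #|J :&: B'|)%N ->
  exists x y, [/\ x \in B :\: J, y \in J :\: B & (y |: (B :\ x)) \in bases].
Proof.
move=> Bb; have [m] := ubnP #|B' :\: B|; elim: m B' => // m IHm B' lt_m B'b ltJ.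
have [sJ|/subsetPn[z zD zJ]] := boolP (B' :\: B \subset J); last first.
  have [y yD Cb] := exchange B'b Bb zD.
  move: (yD); rewrite inE => /andP[yB' yB].
  apply: (IHm _ _ Cb).
    by rewrite -ltnS; apply: leq_trans lt_m; rewrite ltnS exchange_setD.
  apply: (leq_trans ltJ); apply/subset_leq_card/subsetP=> u.
  rewrite !inE => /andP[uJ uB']; rewrite uJ uB' andbT /=.
  by apply/orP; right; apply: contraNneq zJ => <-.
(* If [B :\: J] lay inside [B'], the strict inequality in [J] would make [B'] larger than [B]. *)
have [x xD] : exists x, x \in B :\: J :\: B'.
  apply/set0Pn/negP; rewrite setD_eq0 => sBJ.
  have: (#|B :\: J| <= #|B' :\: J|)%N.
    apply/subset_leq_card/subsetP=> u uD; rewrite inE (subsetP sBJ _ uD).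
    by move: uD; rewrite inE => /andP[->].
  have := card_basis Bb B'b.
  rewrite -(cardsID J B) -(cardsID J B') ![_ :&: J]setIC => e; lia.
move: xD; rewrite !inE => /and3P[xB' xJ xB].
have xD : x \in B :\: B' by rewrite inE xB xB'.
have [y yD Cb] := exchange Bb B'b xD.
exists x, y; split=> //; first by rewrite inE xB xJ.
by rewrite inE (subsetP sJ _ yD) andbT; move: yD; rewrite inE => /andP[].
Qed.

Lemma leq_rk (J B : {set I}) : B \in bases -> (#|J :&: B| <= rk bases J)%N.
Proof. by move=> Bb; apply: (@leq_bigmax_cond _ (mem bases) (fun C => #|J :&: C|)). Qed.

Lemma rk_attained (J : {set I}) : exists2 B, B \in bases & rk bases J = #|J :&: B|.
Proof.
have card0 : (0 < #|bases|)%N by rewrite card_gt0 bases_matroid.1.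
have [B Bb rkE] := @eq_bigmax_cond _ (mem bases) (fun C => #|J :&: C|) card0.
by exists B.
Qed.

(* A basis maximising the sum of the intersection sizes is optimal for every
   member of the flag: moving an element into [J k] decreases no other term. *)
Lemma flag_basis m (J : 'I_m -> {set I}) :
  {homo J : i j / (i <= j)%N >-> i \subset j} ->
  exists2 B, B \in bases & forall i, rk bases (J i) = #|J i :&: B|.
Proof.
move=> Jmono; have [B0 B0b] := set0Pn _ bases_matroid.1.
pose F (B : {set I}) := (\sum_i #|J i :&: B|)%N.
have [B Bb Bmax] := arg_maxnP F B0b.
exists B => // k; apply/eqP; rewrite eqn_leq leq_rk // andbT.
rewrite leqNgt; apply/negP=> lt_k.
have [B' B'b rkE] := rk_attained (J k).
rewrite rkE in lt_k.
have [x [y []]] := exchange_into Bb B'b lt_k.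
rewrite !inE => /andP[xJ xB] /andP[yB yJ] Cb.
set C := _ |: _ in Cb.
(* From [k] on, [y] makes up for the loss of [x]; at [k] nothing is lost since [x] is outside [J k],
   and hence nothing before [k] either. *)
have leC i : (#|J i :&: B| + (i == k) <= #|J i :&: C|)%N.
  have [ki|ik] := leqP k i.
    have yi : y \in J i by apply: (subsetP (Jmono _ _ ki)).
    have sub : y |: (J i :&: B :\ x) \subset J i :&: C.
      apply/subsetP=> u; rewrite !inE => /orP[/eqP->|/and3P[-> -> ->]].
        by rewrite yi eqxx.
      by rewrite orbT.
    apply: leq_trans (subset_leq_card sub).
    rewrite cardsU1 !inE (negPf yB) !andbF /= (cardsD1 x (J i :&: B)) !inE xB andbT.
    have [->|_] := eqVneq i k; first by rewrite (negPf xJ) addnC.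
    by rewrite addn0 leq_add2r leq_b1.
  have -> : (i == k) = false by apply: contraTF ik => /eqP->; rewrite ltnn.
  rewrite addn0; apply/subset_leq_card/subsetP=> u; rewrite !inE => /andP[uJ uB].
  rewrite uJ uB andbT /=; apply/orP; right.
  by apply: contraNneq xJ => <-; apply: (subsetP (Jmono _ _ (ltnW ik))).
have := Bmax _ Cb; rewrite /F => /leq_trans/(_ (leqnn _)).
apply/negP; rewrite -ltnNge.
apply: (@leq_trans (\sum_i (#|J i :&: B| + (i == k)))%N); last exact: leq_sum.
by rewrite big_split /= (bigD1 k (F := fun i => nat_of_bool (i == k))) //= eqxx; lia.
Qed.

End Bases.

(** * Polyhedra and elimination of coordinates *)

Definition ind (R : realFieldType) (P : Prop) : R :=
  if excluded_middle_informative P then 1 else 0.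

Lemma indT (R : realFieldType) (P : Prop) : P -> ind R P = 1.
Proof. by rewrite /ind; case: excluded_middle_informative. Qed.

Lemma indF (R : realFieldType) (P : Prop) : ~ P -> ind R P = 0.
Proof. by rewrite /ind; case: excluded_middle_informative. Qed.

Lemma eq_ind (R : realFieldType) (P Q : Prop) : (P <-> Q) -> ind R P = ind R Q.
Proof.
move=> PQ; case: (excluded_middle_informative P) => p.
  by rewrite !indT //; apply/PQ.
by rewrite !indF // => /PQ.
Qed.

Lemma ind_bool (R : realFieldType) (b : bool) : ind R b = b%:R.
Proof. by case: b; [rewrite indT|rewrite indF]. Qed.

(** Grouping by the value of [g] turns the sum into a combination of the [F w] whose coefficients
    are the fibre weights. *)
Lemma sum_fibers (R : pzRingType) (V : lmodType R) (T W : eqType)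
    (r : seq T) (c : T -> R) (g : T -> W) (F : W -> V) :
  (forall w, \sum_(k <- r) c k * (g k == w)%:R = 0) ->
  \sum_(k <- r) c k *: F (g k) = 0.
Proof.
move=> sum0; transitivity (\sum_(w <- undup (map g r))
    (\sum_(k <- r) c k * (g k == w)%:R) *: F w); last first.
  by apply: big1 => w _; rewrite sum0 scale0r.
under [RHS]eq_bigr do rewrite scaler_suml.
rewrite exchange_big /=; apply: eq_big_seq => k kr.
rewrite (bigD1_seq (g k)) ?undup_uniq ?mem_undup ?map_f //= eqxx mulr1.
by rewrite big1 ?addr0 // => w; rewrite eq_sym => /negPf->; rewrite mulr0 scale0r.
Qed.

(** * Systems of linear inequalities in one variable *)

Section OneVariable.
Variable R : realFieldType.

Lemma separating_point (L U : seq R) :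
  {in L & U, forall l u, l <= u} ->
  exists t, {in L, forall l, l <= t} /\ {in U, forall u, t <= u}.
Proof.
elim: L => [_|l L IHL leLU].
  elim: U => [|u U [t [_ tU]]]; first by exists 0.
  exists (Num.min u t); split=> // v; rewrite inE => /predU1P[->|/tU tv].
    by rewrite ge_min lexx.
  by rewrite ge_min tv orbT.
have [l' u lL uU|t [Lt tU]] := IHL.
  by apply: leLU => //; rewrite inE lL orbT.
exists (Num.max l t); split=> v; rewrite ?inE.
  by move=> /predU1P[->|/Lt vt]; rewrite le_max ?lexx // vt orbT.
by move=> vU; rewrite ge_max tU // leLU ?mem_head.
Qed.

(** Negative coefficients give lower bounds for [t] and positive ones upper bounds;
    cross-multiplying keeps their comparison linear in the right-hand sides. *)
Lemma fourier_motzkin (q : seq (R * R)) :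
  (exists t, {in q, forall p, p.1 * t <= p.2}) <->
  {in q, forall p, p.1 = 0 -> 0 <= p.2} /\
  {in q &, forall p p', 0 < p.1 -> p'.1 < 0 -> p'.1 * p.2 <= p.1 * p'.2}.
Proof.
split=> [[t tq]|[q0 qpn]].
  split=> [p /tq pt p0|p p' /tq pt /tq p't p_gt0 p'_lt0].
    by rewrite p0 mul0r in pt.
  apply: (@le_trans _ _ (p.1 * p'.1 * t)).
    by rewrite -mulrA mulrCA ler_nM2l.
  by rewrite -mulrA ler_pM2l.
have [l u|t [tL tU]] := @separating_point
    [seq p.2 / p.1 | p <- q & p.1 < 0] [seq p.2 / p.1 | p <- q & 0 < p.1].
  move=> /mapP[p' + ->] /mapP[p + ->]; rewrite !mem_filter.
  move=> /andP[p'0 p'q] /andP[p0 pq].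
  by rewrite ler_pdivlMr // mulrAC ler_ndivrMr // [leLHS]mulrC [leRHS]mulrC qpn.
exists t => p pq; case: (ltgtP p.1 0) => p0.
- by rewrite mulrC -ler_ndivrMr // tL //; apply/mapP; exists p; rewrite ?mem_filter ?p0.
- by rewrite mulrC -ler_pdivlMr // tU //; apply/mapP; exists p; rewrite ?mem_filter ?p0.
- by rewrite p0 mul0r q0.
Qed.

Lemma interval_constraints (q : seq (R * R)) (lo hi : R) :
  exists lh : R * R, forall t,
    (lo <= t <= hi /\ {in q, forall p, p.1 * t <= p.2}) <-> lh.1 <= t <= lh.2.
Proof.
elim: q => [|p q [lh IHq]]; first by exists (lo, hi) => t; split=> [[]|].
have [lh' E] : exists lh' : R * R, forall t,
    (p.1 * t <= p.2) && (lh.1 <= t <= lh.2) = (lh'.1 <= t <= lh'.2).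
  case: (ltgtP p.1 0) => p0.
  - exists (Num.max lh.1 (p.2 / p.1), lh.2) => t /=.
    by rewrite ge_max ler_ndivrMr // [t * _]mulrC andbA [X in X && _]andbC.
  - exists (lh.1, Num.min lh.2 (p.2 / p.1)) => t /=.
    by rewrite le_min ler_pdivlMr // [t * _]mulrC andbC andbA.
  - have [p2|p2] := lerP 0 p.2.
      by exists lh => t; rewrite p0 mul0r p2.
    (* The constraint is unsatisfiable, and [(1, 0)] encodes the empty interval. *)
    exists (1, 0) => t /=; rewrite p0 mul0r leNgt p2 /=; apply/esym/negP => /andP[]; lra.
exists lh' => t; rewrite -E; split.
  move=> [lot tq]; rewrite tq ?mem_head //=; apply/IHq; split=> // p' p'q.
  by rewrite tq // inE p'q orbT.
move=> /andP[pt /IHq[-> tq]]; split=> // p'; rewrite inE => /predU1P[->//|].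
exact: tq.
Qed.

Lemma small_gap (h : R) (v : seq R) :
  exists2 e, 0 < e & {in v, forall x, h < x -> h + e < x}.
Proof.
elim: v => [|x v [e e0 IHv]]; first by exists 1.
have [hx|xh] := ltrP h x; last first.
  exists e => // y; rewrite inE => /predU1P[-> hx|/IHv//]; first by lra.
exists (Num.min e ((x - h) / 2)); first by rewrite lt_min e0 /=; lra.
move=> y; rewrite inE => /predU1P[-> _|/IHv yv /yv hy].
  have: Num.min e ((x - h) / 2) <= (x - h) / 2 by rewrite ge_min lexx orbT.
  lra.
have: Num.min e ((x - h) / 2) <= e by rewrite ge_min lexx.
lra.
Qed.

(* The value of the sum at [h] minus its value just to the right of [h] is the
   total weight of the nonempty intervals with right end point [h]. *)
Lemma euler_interval (T : eqType) (r : seq T) (c lo hi : T -> R) :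
  (forall t, \sum_(k <- r) c k * (lo k <= t <= hi k)%R%:R = 0) ->
  \sum_(k <- r) c k * (lo k <= hi k)%R%:R = 0.
Proof.
move=> sum0.
have end0 h : \sum_(k <- r) c k * ((lo k <= hi k) && (hi k == h))%R%:R = 0.
  (* No end point lies in []h, h + e]], so among the nonempty intervals containing [h] exactly those
     ending there miss [h + e]. *)
  have [e e0 gap] := small_gap h (map lo r ++ map hi r).
  transitivity (\sum_(k <- r) c k * (lo k <= h <= hi k)%R%:R
      - \sum_(k <- r) c k * (lo k <= h + e <= hi k)%R%:R); last first.
    by rewrite !sum0 subrr.
  rewrite -sumrB; apply: eq_big_seq => k kr; rewrite -mulrBr; congr (_ * _).
  have /gap glo : lo k \in map lo r ++ map hi r by rewrite mem_cat map_f.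
  have /gap ghi : hi k \in map lo r ++ map hi r by rewrite mem_cat map_f ?orbT.
  have -> : (lo k <= h + e) = (lo k <= h).
    by have [lh|/glo] := lerP (lo k) h; [apply/idP|move=> ?; apply/negP]; lra.
  case: (ltgtP (hi k) h) => [hh|hh|->].
  - have -> : (h + e <= hi k) = false by apply/negP; lra.
    by rewrite !andbF subrr.
  - by rewrite (ltW (ghi hh)) subrr andbF.
  - have -> : (h + e <= h) = false by apply/negP; lra.
    by rewrite !andbT andbF subr0.
under eq_bigr do rewrite -[_ * _]mulr1.
apply: (@sum_fibers _ R^o _ _ _ _ hi (fun=> 1)) => h; rewrite -[RHS](end0 h).
by apply: eq_bigr => k _; rewrite -mulrA -natrM mulnb.
Qed.

End OneVariable.

(** * Polyhedra and their projections *)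

Section Polyhedra.
Variables (R : realFieldType) (J : finType).
Implicit Types (S : (J -> R) -> Prop) (x : J -> R) (j : J).

Local Notation constraint := ({ffun J -> R} * R)%type.

Definition linear_form (f : (J -> R) -> R) : Prop :=
  exists a : {ffun J -> R}, forall x, f x = \sum_j a j * x j.

Definition polyhedral S : Prop :=
  exists s : seq constraint,
    forall x, S x <-> {in s, forall p : constraint, \sum_j p.1 j * x j <= p.2}.

Lemma linear_form_coord j : linear_form (fun x => x j).
Proof.
exists [ffun k => (k == j)%:R] => x; rewrite (bigD1 j) //= ffunE eqxx mul1r.
by rewrite big1 ?addr0 // => k /negPf kj; rewrite ffunE kj mul0r.
Qed.

Lemma linear_formD f g :
  linear_form f -> linear_form g -> linear_form (fun x => f x + g x).
Proof.
move=> [a fE] [b gE]; exists [ffun k => a k + b k] => x.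
by rewrite fE gE -big_split; apply: eq_bigr => k _; rewrite ffunE mulrDl.
Qed.

Lemma linear_formZ u f : linear_form f -> linear_form (fun x => u * f x).
Proof.
move=> [a fE]; exists [ffun k => u * a k] => x.
by rewrite fE mulr_sumr; apply: eq_bigr => k _; rewrite ffunE mulrA.
Qed.

Lemma linear_form_sum (K : Type) (r : seq K) (P : pred K) (F : K -> (J -> R) -> R) :
  (forall k, linear_form (F k)) -> linear_form (fun x => \sum_(k <- r | P k) F k x).
Proof.
move=> Flin; elim: r => [|k r [a IHr]].
  exists [ffun=> 0] => x; rewrite big_nil big1 // => k _.
  by rewrite ffunE mul0r.
have [b FE] := Flin k; exists [ffun i => (P k)%:R * b i + a i] => x.
rewrite big_cons IHr.
under [RHS]eq_bigr do rewrite ffunE mulrDl -mulrA.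
rewrite big_split /= -mulr_sumr -FE.
by case: (P k); rewrite ?mul1r // mul0r add0r.
Qed.

Lemma eq_polyhedral S S' : (forall x, S x <-> S' x) -> polyhedral S -> polyhedral S'.
Proof.
by move=> SS' [s sE]; exists s => x; split=> [/SS'/sE//|/sE/SS'].
Qed.

Lemma polyhedralT : polyhedral (fun=> True).
Proof. by exists [::]. Qed.

Lemma polyhedralI S S' :
  polyhedral S -> polyhedral S' -> polyhedral (fun x => S x /\ S' x).
Proof.
move=> [s sE] [s' sE']; exists (s ++ s') => x; split.
  by move=> [/sE xs /sE' xs'] p; rewrite mem_cat => /orP[/xs|/xs'].
by move=> xs; split; [apply/sE|apply/sE'] => p ps; apply: xs; rewrite mem_cat ps ?orbT.
Qed.

Lemma polyhedral_le f c : linear_form f -> polyhedral (fun x => f x <= c).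
Proof.
move=> [a fE]; exists [:: (a, c)] => x; rewrite fE; split=> [xc p|].
  by rewrite inE => /eqP->.
by move=> /(_ _ (mem_head _ _)).
Qed.

Lemma polyhedral_ge f c : linear_form f -> polyhedral (fun x => c <= f x).
Proof.
move=> /(linear_formZ (-1))/(polyhedral_le (- c)).
by apply: eq_polyhedral => x; rewrite mulN1r lerN2.
Qed.

Lemma polyhedral_eq f c : linear_form f -> polyhedral (fun x => f x = c).
Proof.
move=> flin; have := polyhedralI (polyhedral_le c flin) (polyhedral_ge c flin).
apply: eq_polyhedral => x; split=> [[fc cf]|->]; last by split.
by apply/eqP; rewrite eq_le fc cf.
Qed.

Lemma polyhedral_forall (K : finType) (S : K -> (J -> R) -> Prop) :
  (forall k, polyhedral (S k)) -> polyhedral (fun x => forall k, S k x).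
Proof.
move=> Spol.
suff [s sE] : polyhedral (fun x => {in enum K, forall k, S k x}).
  by exists s => x; split=> [xS|/sE xS k]; [apply/sE|apply: xS; rewrite mem_enum].
elim: (enum K) => [|k r IHr]; first by apply: eq_polyhedral polyhedralT.
apply: eq_polyhedral (polyhedralI (Spol k) IHr) => x; split.
  by move=> [xk xr] i; rewrite inE => /predU1P[->|/xr].
by move=> xr; split=> [|i ir]; apply: xr; rewrite inE ?eqxx ?ir ?orbT.
Qed.

Definition upd x j (t : R) : J -> R := fun k => if k == j then t else x k.

Lemma sum_upd (a : {ffun J -> R}) x j t :
  \sum_k a k * upd x j t k = a j * t + \sum_(k | k != j) a k * x k.
Proof.
rewrite (bigD1 j) //= /upd eqxx; congr (_ + _).
by apply: eq_bigr => k /negPf->.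
Qed.

Lemma fiber_constraints S : polyhedral S -> exists s : seq constraint,
  forall x j t, S (upd x j t) <->
    {in [seq (p.1 j, p.2 - \sum_(k | k != j) p.1 k * x k) | p : constraint <- s],
       forall q : R * R, q.1 * t <= q.2}.
Proof.
move=> [s sE]; exists s => x j t; split.
  by move=> /sE xs _ /mapP[p /xs + ->] /=; rewrite sum_upd lerBrDr.
move=> xs; apply/sE => p ps; rewrite sum_upd -lerBrDr.
exact: (xs _ (map_f _ ps)).
Qed.

(** Constraints free of [x j] are kept; each pair with coefficients of opposite signs at [j] is
    combined with positive multipliers that cancel [x j]. *)
Lemma polyhedral_ex S j :
  polyhedral S -> polyhedral (fun x => exists t, S (upd x j t)).
Proof.
move=> /fiber_constraints[s sE].
pose zero := [seq p : constraint <- s | p.1 j == 0].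
pose pos := [seq p : constraint <- s | 0 < p.1 j].
pose neg := [seq p : constraint <- s | p.1 j < 0].
pose comb (p p' : constraint) : constraint :=
  ([ffun k => p.1 j * p'.1 k - p'.1 j * p.1 k], p.1 j * p'.2 - p'.1 j * p.2).
exists (zero ++ [seq comb p p' | p <- pos, p' <- neg]) => x.
pose rest (p : constraint) := \sum_(k | k != j) p.1 k * x k.
have sumE (p : constraint) : \sum_k p.1 k * x k = p.1 j * x j + rest p by rewrite (bigD1 j).
have combE (p p' : constraint) : \sum_k (comb p p').1 k * x k = p.1 j * rest p' - p'.1 j * rest p.
  rewrite sumE /rest /= ffunE mulrC [p'.1 j * _]mulrC subrr mulr0 add0r.
  rewrite !mulr_sumr -sumrB; apply: eq_bigr => k _; rewrite ffunE; ring.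
set q := fun p : constraint => (p.1 j, p.2 - rest p).
have fm := fourier_motzkin (map q s).
have exE : (exists t, S (upd x j t)) <->
    (exists t, {in map q s, forall p, p.1 * t <= p.2}).
  by split=> -[t xt]; exists t; apply/(sE x j t).
split.
  move=> /exE/fm[q0 qpn] p; rewrite mem_cat => /orP[|/allpairsP[[p1 p2] /= []]].
    rewrite mem_filter => /andP[/eqP p0 ps].
    by rewrite sumE p0 mul0r add0r -subr_ge0; apply: (q0 _ (map_f q ps)).
  rewrite !mem_filter => /andP[p1_gt0 p1s] /andP[p2_lt0 p2s] ->.
  have /= := qpn _ _ (map_f q p1s) (map_f q p2s) p1_gt0 p2_lt0.
  by rewrite combE /= !mulrBr; lra.
move=> xs; apply/exE/fm; split=> [_ /mapP[p ps ->] /= p0|].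
  rewrite subr_ge0; have := xs p; rewrite sumE p0 mul0r add0r; apply.
  by rewrite mem_cat mem_filter p0 eqxx ps.
move=> _ _ /mapP[p ps ->] /mapP[p' p's ->] /= p_gt0 p'_lt0.
have := xs (comb p p'); rewrite combE /= => xpp'.
have {xpp'}/xpp' : comb p p' \in zero ++ [seq comb p p' | p <- pos, p' <- neg].
  by rewrite mem_cat allpairs_f ?orbT // mem_filter ?p_gt0 ?p'_lt0.
by rewrite !mulrBr; lra.
Qed.

(* Projection along the coordinates in [js], kept as a cylinder in the same
   space so that the dimension never changes. *)
Definition exs (js : seq J) S x : Prop :=
  exists2 z, {in [predC js], z =1 x} & S z.

Lemma exs_cons j js S x : exs (j :: js) S x <-> exists t, exs js S (upd x j t).
Proof.
split=> [[z zx Sz]|[t [z zx Sz]]].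
  exists (z j), z => // k; rewrite /upd !inE => kjs.
  by have [->//|kj] := eqVneq k j; apply: zx; rewrite !inE negb_or kj.
exists z => // k; rewrite !inE negb_or => /andP[/negPf kj kjs].
by rewrite zx // /upd kj.
Qed.

Lemma polyhedral_exs js S : polyhedral S -> polyhedral (exs js S).
Proof.
move=> Spol; elim: js => [|j js IHjs].
  have [s sE] := Spol; exists s => x; split=> [[z zx /sE Sz] p /Sz|/sE Sx].
    by under eq_bigr do rewrite zx //.
  by exists x.
by apply: eq_polyhedral (polyhedral_ex j IHjs) => x; apply: iff_sym; apply: exs_cons.
Qed.

(** * Linear relations between indicators under projection *)

Section Euler.
Variables (T : eqType) (r : seq T) (c : T -> R).

(** On each line in direction [j] the sets [S k] cut out closed intervals, bounded by the hypothesis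
    on [x j], so the one-variable case [euler_interval] applies. *)
Lemma euler_ex (S : T -> (J -> R) -> Prop) j :
  {in r, forall k, polyhedral (S k)} ->
  {in r, forall k x, S k x -> 0 <= x j <= 1} ->
  (forall x, \sum_(k <- r) c k * ind R (S k x) = 0) ->
  forall x, \sum_(k <- r) c k * ind R (exists t, S k (upd x j t)) = 0.
Proof.
move=> Spol Sbnd sum0 x.
have fiber k : exists lh : R * R,
    k \in r -> forall t, S k (upd x j t) <-> lh.1 <= t <= lh.2.
  (* The default [(0, 0)] off [r] makes the end points a total function of [k]. *)
  case: (boolP (k \in r)) => [kr|_]; last by exists (0, 0).
  have [s sE] := fiber_constraints (Spol k kr).
  have [lh lhE] := interval_constraints
    [seq (p.1 j, p.2 - \sum_(k | k != j) p.1 k * x k) | p : constraint <- s] 0 1.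
  exists lh => _ t; split=> [St|/lhE[_ /sE]//].
  apply/lhE; split; last exact/sE.
  by have := Sbnd k kr _ St; rewrite /upd eqxx.
pose lh k := proj1_sig (constructive_indefinite_description _ (fiber k)).
have lhP k : k \in r -> forall t, S k (upd x j t) <-> (lh k).1 <= t <= (lh k).2.
  exact: (proj2_sig (constructive_indefinite_description _ (fiber k))).
rewrite -[RHS](@euler_interval _ _ r c (fun k => (lh k).1) (fun k => (lh k).2)).
  apply: eq_big_seq => k kr; rewrite -ind_bool; congr (_ * _); apply: eq_ind.
  split=> [[t /(lhP k kr)/andP[]]|le_lh]; first exact: le_trans.
  by exists (lh k).1; apply/(lhP k kr); rewrite lexx.
move=> t; rewrite -[RHS](sum0 (upd x j t)); apply: eq_big_seq => k kr.
by rewrite -ind_bool; congr (_ * _); apply: eq_ind; apply: iff_sym; apply: lhP.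
Qed.

(** Coordinates are eliminated one by one; as [js] has no repetition, the bound on coordinate [j]
    survives projection along the others. *)
Lemma euler_exs (S : T -> (J -> R) -> Prop) (js : seq J) :
  uniq js ->
  {in r, forall k, polyhedral (S k)} ->
  {in r, forall k x, S k x -> {in js, forall j, 0 <= x j <= 1}} ->
  (forall x, \sum_(k <- r) c k * ind R (S k x) = 0) ->
  forall x, \sum_(k <- r) c k * ind R (exs js (S k) x) = 0.
Proof.
move=> + Spol + sum0; elim: js => [_ _ x|j js IHjs /= /andP[jjs ujs] Sbnd x].
  rewrite -[RHS](sum0 x); apply: eq_big_seq => k kr; congr (_ * _).
  apply: eq_ind; split=> [[z zx Sz]|Sx]; last by exists x.
  (* A polyhedral set sees only the values of a point, so pointwise equality suffices. *)
  have [s sE] := Spol k kr; apply/sE => p ps.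
  by under eq_bigr do rewrite -zx //; apply: (sE z).1.
under eq_bigr do rewrite (eq_ind _ (exs_cons _ _ _ _)).
apply: (euler_ex (S := fun k => exs js (S k))) => [k kr|k kr y [z zy Sz]|].
- exact/polyhedral_exs/Spol.
- by rewrite -zy ?inE //; apply: (Sbnd k kr z Sz); rewrite mem_head.
- apply: IHjs => // k kr y Sy i ijs.
  by apply: (Sbnd k kr y Sy); rewrite inE ijs orbT.
Qed.

End Euler.
End Polyhedra.

(** * Matroid polytopes *)

Section MatroidPolytopes.
Variables (R : realFieldType) (I : finType).

Lemma in_polytope_ge0_le1 (bases : {set {set I}}) (x : I -> R) i :
  in_polytope bases x -> 0 <= x i <= 1.
Proof.
move=> [lam [lam0 [lam1 ->]]]; apply/andP; split.
  by apply: sumr_ge0 => B _; rewrite mulr_ge0.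
by rewrite -[leRHS]lam1; apply: ler_sum => B _; rewrite ler_piMr // lern1 leq_b1.
Qed.

(** The polytope is the projection of a polyhedron with extra coordinates [inr B] holding the convex
    weights. *)
Lemma polyhedral_in_polytope (bases : {set {set I}}) :
  polyhedral (fun y : I + {set I} -> R => in_polytope bases (fun i => y (inl i))).
Proof.
pose Q (y : I + {set I} -> R) := (forall B, 0 <= y (inr B)) /\
  (\sum_(B in bases) y (inr B) = 1 /\
   forall i, y (inl i) + -1 * \sum_(B in bases) (i \in B)%:R * y (inr B) = 0).
have Qpol : polyhedral Q.
  apply: polyhedralI; first by apply: polyhedral_forall => B;
    apply: polyhedral_ge; apply: linear_form_coord.
  apply: polyhedralI.
    by apply: polyhedral_eq; apply: linear_form_sum => B; apply: linear_form_coord.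
  apply: polyhedral_forall => i; apply: polyhedral_eq; apply: linear_formD.
    exact: linear_form_coord.
  apply: linear_formZ; apply: linear_form_sum => B; apply: linear_formZ.
  exact: linear_form_coord.
apply: eq_polyhedral (polyhedral_exs (map inr (enum {set I})) Qpol) => y.
split=> [[z zy [z0 [z1 zE]]]|[lam [lam0 [lam1 lamE]]]].
  exists (fun B => z (inr B)); split=> //; split=> // i.
  rewrite -zy ?inE; last by apply/mapP => -[].
  have /eqP := zE i; rewrite mulN1r subr_eq0 => /eqP->.
  by apply: eq_bigr => B _; rewrite mulrC.
exists (fun k => match k with inl i => y (inl i) | inr B => lam B end).
  by case=> [//|B]; rewrite !inE map_f // mem_enum.
split=> //; split=> // i; rewrite lamE mulN1r; apply/eqP; rewrite subr_eq0.
by apply/eqP; apply: eq_bigr => B _; rewrite mulrC.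
Qed.

(** Multiplying the relation by the indicator of [K] and projecting along all coordinates of [I]
    leaves only whether each intersection is nonempty. *)
Lemma euler_polytopes (s : seq (R * {set {set I}})) (K : (I -> R) -> Prop) :
  polyhedral (fun y : I + {set I} -> R => K (fun i => y (inl i))) ->
  (forall x, \sum_(p <- s) p.1 * indicator_polytope p.2 x = 0) ->
  \sum_(p <- s) p.1 * ind R (exists x, in_polytope p.2 x /\ K x) = 0.
Proof.
move=> Kpol sum0.
pose S (p : R * {set {set I}}) (y : I + {set I} -> R) :=
  in_polytope p.2 (fun i => y (inl i)) /\ K (fun i => y (inl i)).
pose js : seq (I + {set I}) := map inl (enum I).
(* The base point [0] is arbitrary: the coordinates [inl i] are projected away and [S] ignores the
   others. *)
rewrite -[RHS](@euler_exs _ _ _ s fst S js _ _ _ _ (fun=> 0)).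
- apply: eq_bigr => p _; congr (_ * _); apply: eq_ind.
  split=> [[x [xP xK]]|[z _ [zP zK]]]; last by exists (fun i => z (inl i)).
  exists (fun k => match k with inl i => x i | inr _ => 0 end) => //.
  by case=> [i|//]; rewrite !inE map_f // mem_enum.
- by rewrite map_inj_uniq ?enum_uniq // => i i' [].
- by move=> p _; apply: polyhedralI (polyhedral_in_polytope _) Kpol.
- by move=> p _ y [yP _] _ /mapP[i _ ->]; apply: in_polytope_ge0_le1 yP.
- move=> y; case: (excluded_middle_informative (K (fun i => y (inl i)))) => yK.
    rewrite -[RHS](sum0 (fun i => y (inl i))); apply: eq_bigr => p _; congr (_ * _).
    by rewrite -[RHS]/(ind R _); apply: eq_ind; split=> [[]|].
  by apply: big1 => p _; rewrite indF ?mulr0 // => -[].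
Qed.

(** * Rank vectors along a flag *)

Section Flag.
Variables (m : nat) (J : 'I_m -> {set I}).
Hypothesis J_mono : {homo J : i j / (i <= j)%N >-> i \subset j}.

(** At [t = 0] the last inequality follows from the others; at [t = (\sum_i r i).+1] it rules out
    equality throughout. *)
Definition flag_region (r : 'I_m -> nat) (t : nat) (x : I -> R) : Prop :=
  (forall i, (r i)%:R <= \sum_(e in J i) x e) /\
  t%:R <= \sum_i \sum_(e in J i) x e.

Lemma polyhedral_flag_region r t : polyhedral
  (fun y : I + {set I} -> R => flag_region r t (fun i => y (inl i))).
Proof.
apply: polyhedralI.
  apply: polyhedral_forall => i; apply: polyhedral_ge; apply: linear_form_sum => e.
  exact: linear_form_coord.
apply: polyhedral_ge; apply: linear_form_sum => i; apply: linear_form_sum => e.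
exact: linear_form_coord.
Qed.

Lemma sum_mem_card (A B : {set I}) : (\sum_(e in A) (e \in B))%N = #|A :&: B|.
Proof. by rewrite -big_mkcondr /= sum1dep_card; apply: eq_card => e; rewrite !inE. Qed.

Lemma in_polytope_le_rk (bases : {set {set I}}) (x : I -> R) (A : {set I}) :
  in_polytope bases x -> \sum_(e in A) x e <= (rk bases A)%:R.
Proof.
move=> [lam [lam0 [lam1 xE]]].
under eq_bigr do rewrite xE.
rewrite exchange_big /= -[leRHS]mul1r -[X in _ <= X * _]lam1 mulr_suml.
apply: ler_sum => B Bb; rewrite -mulr_sumr ler_wpM2l // -natr_sum ler_nat.
by rewrite sum_mem_card leq_rk.
Qed.

(** Ranks bound the sums over [J i] on the polytope, and the vertex of one basis from [flag_basis]
    attains all these bounds at once. *)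
Lemma flag_region_meets (bases : {set {set I}}) r t : is_matroid bases ->
  (exists x : I -> R, in_polytope bases x /\ flag_region r t x) <->
  (forall i, r i <= rk bases (J i))%N /\ (t <= \sum_i rk bases (J i))%N.
Proof.
move=> bm; split=> [[x [xP [xr xt]]]|[rJ tJ]].
  split=> [i|]; rewrite -(ler_nat R); first exact: le_trans (in_polytope_le_rk _ xP).
  rewrite natr_sum; apply: (le_trans xt); apply: ler_sum => i _.
  exact: in_polytope_le_rk.
have [B Bb BE] := flag_basis bm J_mono.
have sumE i : \sum_(e in J i) (e \in B)%:R = (rk bases (J i))%:R :> R.
  by rewrite -natr_sum sum_mem_card BE.
exists (fun e => (e \in B)%:R); split.
  exists (fun C => (C == B)%:R); split=> [C|]; first exact: ler0n.
  have sum1 (F : {set I} -> R) : \sum_(C in bases) (C == B)%:R * F C = F B.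
    rewrite (bigD1 B) //= eqxx mul1r big1 ?addr0 // => C /andP[_ /negPf->].
    by rewrite mul0r.
  split=> [|e]; last by rewrite sum1.
  by under eq_bigr do rewrite -[_%:R]mulr1; rewrite sum1.
split=> [i|]; first by rewrite sumE ler_nat.
by under eq_bigr do rewrite sumE; rewrite -natr_sum ler_nat.
Qed.

(* Among the rank vectors dominating [r], only [r] itself fails to have
   coordinate sum larger than that of [r]. *)
Lemma flag_rank_valuation (s : seq (R * {set {set I}})) (r : {ffun 'I_m -> nat}) :
  (forall p, p \in s -> is_matroid p.2) ->
  (forall x, \sum_(p <- s) p.1 * indicator_polytope p.2 x = 0) ->
  \sum_(p <- s) p.1 * ([ffun i => rk p.2 (J i)] == r)%:R = 0.
Proof.
move=> sm sum0.
have N t := euler_polytopes (polyhedral_flag_region r t) sum0.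
rewrite -[RHS](subrr (0 : R)) -[X in _ = X - _](N 0%N).
rewrite -[X in _ = _ - X](N (\sum_i r i).+1) -sumrB.
apply: eq_big_seq => p ps; rewrite -mulrBr; congr (_ * _).
rewrite !(eq_ind _ (flag_region_meets _ _ (sm p ps))).
have [rE|rN] := eqVneq; last have [rle|rnle] :=
    excluded_middle_informative (forall i, (r i <= rk p.2 (J i))%N).
- have rkE i : rk p.2 (J i) = r i by rewrite -rE ffunE.
  rewrite indT; last by split=> // i; rewrite rkE.
  rewrite indF ?subr0 // => -[_].
  by rewrite (eq_bigr _ (fun i _ => rkE i)) ltnn.
- rewrite !indT ?subrr //; split=> //; rewrite ltn_neqAle leq_sum // andbT.
  apply: contra_neq rN => sumE; apply/ffunP => i; rewrite ffunE.
  have := leqif_sum (fun i _ => leqif_eq (rle i)).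
  by move=> /(_ xpredT)[_]; rewrite sumE eqxx => /esym/forallP/(_ i)/eqP.
- by rewrite !indF ?subrr // => -[].
Qed.

End Flag.

(** * Jump words and the invariant [Gval] *)

Definition initial_segment n (l : {ffun 'I_n -> I}) (i : 'I_n.+1) : {set I} :=
  [set l j | j in [set j : 'I_n | (j < i)%N]].

Lemma initial_segment_mono n (l : {ffun 'I_n -> I}) :
  {homo initial_segment l : i j / (i <= j)%N >-> i \subset j}.
Proof.
move=> i j ij; apply: imsetS; apply/subsetP=> k; rewrite !inE => ki.
exact: leq_trans ij.
Qed.

(** Factors [rkjump] through the rank vector of the flag; the two indices are [i + 1] and [i] in
    ['I_n.+1]. *)
Definition jumps n (v : {ffun 'I_n.+1 -> nat}) : {ffun 'I_n -> bool} :=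
  [ffun i : 'I_n => (v (lift ord0 i) - v (widen_ord (leqnSn n) i) == 1)%N].

Lemma rkjumpE n (bases : {set {set I}}) (l : {ffun 'I_n -> I}) :
  rkjump bases l = jumps [ffun i => rk bases (initial_segment l i)].
Proof. by apply/ffunP=> i; rewrite !ffunE. Qed.

(** The relation holds for each linear order separately: its monomial depends only on the rank
    vector, and every rank vector has total weight zero. *)
Lemma Gval_relation n (s : seq (R * {set {set I}})) :
  (forall p, p \in s -> is_matroid p.2) ->
  (forall x, \sum_(p <- s) p.1 * indicator_polytope p.2 x = 0) ->
  \sum_(p <- s) p.1 *: Gval R n p.2 = 0.
Proof.
move=> sm sum0; under eq_bigr do rewrite scaler_sumr.
rewrite exchange_big /=; apply: big1 => l _.
under eq_bigr do rewrite rkjumpE.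
apply: (sum_fibers (g := fun p => [ffun i => rk p.2 (initial_segment l i)])
                   (fun v => Uvar R (jumps v))) => v.
exact: flag_rank_valuation (@initial_segment_mono n l) s v sm sum0.
Qed.

(** Concatenating [s] with the negated [s'] gives a relation; this makes the value of the extension
    independent of the representation. *)
Lemma Gval_indicator n (s s' : seq (R * {set {set I}})) :
  (forall p, p \in s -> is_matroid p.2) ->
  (forall p, p \in s' -> is_matroid p.2) ->
  (forall x, \sum_(p <- s) p.1 * indicator_polytope p.2 x =
             \sum_(p <- s') p.1 * indicator_polytope p.2 x) ->
  \sum_(p <- s) p.1 *: Gval R n p.2 = \sum_(p <- s') p.1 *: Gval R n p.2.
Proof.
move=> sm sm' eqs; apply/eqP; rewrite -subr_eq0 -sumrN; apply/eqP.
have := @Gval_relation n (s ++ [seq (- p.1, p.2) | p <- s']).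
rewrite big_cat big_map /=; under [X in _ + X]eq_bigr do rewrite scaleNr.
apply=> [p|x]; first by rewrite mem_cat => /orP[/sm//|/mapP[q /sm' qm ->]].
rewrite big_cat big_map /=; under [X in _ + X]eq_bigr do rewrite mulNr.
by rewrite sumrN eqs subrr.
Qed.

End MatroidPolytopes.

(** * The linear extension to the span of indicators *)

Theorem theorem7p9 (R : realFieldType) (I : finType) (n : nat)
  (hI : #|I| = n) :
  exists Ghat : ((I -> R) -> R) -> {mpoly R[#|{ffun 'I_n -> bool}|]},
    (forall (f g : (I -> R) -> R) (a b : R),
       in_indicator_span f -> in_indicator_span g ->
       Ghat (fun x => a * f x + b * g x) = a *: Ghat f + b *: Ghat g) /\
    (forall bases : {set {set I}}, is_matroid bases ->
       Gval R n bases = Ghat (indicator_polytope bases)).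
Proof.
(* A representation of [f] is chosen classically; the value [0] off the span is a mere default. *)
pose Ghat (f : (I -> R) -> R) : {mpoly R[#|{ffun 'I_n -> bool}|]} :=
  if excluded_middle_informative (in_indicator_span f) is left fs
  then \sum_(p <- proj1_sig (constructive_indefinite_description _ fs))
         p.1 *: Gval R n p.2
  else 0.
have GhatE f (s : seq (R * {set {set I}})) :
    (forall p, p \in s -> is_matroid p.2) ->
    (forall x, f x = \sum_(p <- s) p.1 * indicator_polytope p.2 x) ->
    Ghat f = \sum_(p <- s) p.1 *: Gval R n p.2.
  move=> sm fE; rewrite /Ghat; case: excluded_middle_informative => [fs|[]].
    case: constructive_indefinite_description => s' [sm' fE'] /=.
    by apply: Gval_indicator => // x; rewrite -fE -fE'.
  by exists s.
exists Ghat; split=> [f g a b [s [sm fE]] [s' [sm' gE]]|bases bm].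
  rewrite (GhatE f s) // (GhatE g s') //.
  rewrite (GhatE _ ([seq (a * p.1, p.2) | p <- s] ++ [seq (b * p.1, p.2) | p <- s'])).
  - rewrite big_cat !big_map /= !scaler_sumr.
    by congr (_ + _); apply: eq_bigr => p _; rewrite scalerA.
  - by move=> p; rewrite mem_cat => /orP[]/mapP[q]; [move/sm|move/sm'] => qm ->.
  - move=> x; rewrite fE gE big_cat !big_map /= !mulr_sumr.
    by congr (_ + _); apply: eq_bigr => p _; rewrite mulrA.
rewrite (GhatE _ [:: (1, bases)]); first by rewrite big_seq1 scale1r.
- by move=> p; rewrite inE => /eqP->.
- by move=> x; rewrite big_seq1 mul1r.
Qed.
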